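(* There is a randomized algorithm which, given a parameter $k$, query access to a monotone function $f:\{0,1\}^n\to\{0,1\}$ with certificate complexity $C(f)\le k$, and an input $x^\star\in\{0,1\}^n$, makes $O(k^8\log n)$ queries to $f$ and with high probability (probability at least $1-1/\mathrm{poly}(n)$) returns a certificate of size at most $k$ for $f$'s value on $x^\star$.
   Context: For $f:\{0,1\}^n\to\{0,1\}$ and $x^\star\in\{0,1\}^n$, a set $S\subseteq[n]$ is a certificate for $f$'s value on $x^\star$ if $f(y)=f(x^\star)$ for every $y\in\{0,1\}^n$ with $y_S=x^\star_S$ (i.e. $y_i=x^\star_i$ for all $i\in S$). $C(f,x^\star)$ is the minimum size of such a certificate and the certificate complexity is $C(f)=\max_{x}C(f,x)$. $f$ is monotone if $x\le y$ coordinatewise implies $f(x)\le f(y)$. A query returns $f(x)$ for a chosen $x$. *)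

(* Defs.v *)
From mathcomp Require Import all_boot all_order all_algebra.
From mathcomp Require Import reals exp.

Set Implicit Arguments.
Unset Strict Implicit.
Unset Printing Implicit Defensive.

Import Order.TTheory GRing.Theory Num.Theory.

Definition cube (n : nat) := {ffun 'I_n -> bool}.

Definition monotone n (f : cube n -> bool) : Prop :=
  forall x y : cube n, (forall i, x i <= y i) -> f x <= f y.

Definition certificate n (f : cube n -> bool) (x : cube n) (S : {set 'I_n}) :
    bool :=
  [forall y : cube n, [forall i in S, y i == x i] ==> (f y == f x)].

Lemma certificateT n (f : cube n -> bool) (x : cube n) :
  certificate f x [set: 'I_n].
Proof.
apply/forallP=> y; apply/implyP=> /forall_inP yx; apply/eqP; congr f.
by apply/ffunP=> i; apply/eqP/yx; rewrite inE.
Qed.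

(* The minimum is over a nonempty family, by certificateT. *)
Definition certificate_complexity_at n (f : cube n -> bool) (x : cube n) :
    nat :=
  #|[arg min_(S < [set: 'I_n] | certificate f x S) #|S|]|.

Definition certificate_complexity n (f : cube n -> bool) : nat :=
  \max_(x : cube n) certificate_complexity_at f x.

(* Randomized query algorithms over the query domain X with output in T, as
   finite trees.  Draw m draws an index uniformly from 'I_m.+1, independently of
   all previous draws.  The function f being queried is not an argument of the
   tree: it influences a run only through the answers at Query nodes. *)
Inductive query_alg (X T : Type) : Type :=
  | Return of T
  | Query of X & (bool -> query_alg X T)
  | Draw (m : nat) of ('I_m.+1 -> query_alg X T).

(* The largest number of queries to f over all outcomes of the draws. *)
Fixpoint queries X T (f : X -> bool) (A : query_alg X T) : nat :=
  match A with
  | Return _ => 0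
  | Query x next => (queries f (next (f x))).+1
  | Draw m next => \max_(i < m.+1) queries f (next i)
  end.

(* The probability that the output of A, run with query access to f, satisfies
   P. *)
Fixpoint output_prob (R : realType) X T (f : X -> bool) (A : query_alg X T)
    (P : pred T) : R :=
  (match A with
  | Return t => (P t)%:R
  | Query x next => output_prob R f (next (f x)) P
  | Draw m next => (\sum_(i < m.+1) output_prob R f (next i) P) / m.+1%:R
  end)%R.

(* Main.v *)
(** Write b for f x, and x|S for the point which agrees with x on S and is equal
  to ~~ b elsewhere.  By monotonicity S certifies the value of f at x as soon as
  f (x|S) = b.  Starting from S empty, repeatedly locate by binary search a q
  such that the union of S and the first q coordinates has this property whereas
  the union of S and the first q - 1 has not, and add the last of these q
  coordinates to S.  Every element i of S is then essential to that union W, in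
  that f (x|(W :\ i)) != b; hence i lies in each certificate at x|W, so that
  #|S| <= k and k rounds are enough.  The algorithm is deterministic and makes
  O(k log n) queries. *)
Require Import Defs.
From mathcomp Require Import all_boot all_order all_algebra.
From mathcomp Require Import reals exp.
From mathcomp Require Import zify ring.

Import Order.TTheory GRing.Theory Num.Theory.
Local Open Scope ring_scope.

Lemma certificate_complexityP {n} {f : cube n -> bool} {k : nat} (x : cube n) :
  (certificate_complexity f <= k)%N ->
  exists2 S : {set 'I_n}, certificate f x S & (#|S| <= k)%N.
Proof.
move=> fk.
have: (certificate_complexity_at f x <= k)%N.
  by apply: leq_trans fk; exact: (leq_bigmax x).
rewrite /certificate_complexity_at; case: arg_minnP => [|S cS _ Sk].
  exact: certificateT.
by exists S.
Qed.

Lemma certificateP {n} {f : cube n -> bool} {x : cube n} {S : {set 'I_n}} :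
  reflect (forall y : cube n, {in S, y =1 x} -> f y = f x) (certificate f x S).
Proof.
apply: (iffP forallP) => fS y.
  by move=> yS; apply/eqP/(implyP (fS y))/forall_inP => i iS; rewrite yS.
by apply/implyP => /forall_inP yS; apply/eqP/fS => i /yS/eqP.
Qed.

Section BinarySearch.
Context {X T : Type} (b : bool) (Q : nat -> X) (next : nat -> query_alg X T).

(** [t] is fuel: no test for [lo = hi] cuts the search short, so every run spends exactly [t]
    queries before [next]. *)
Fixpoint binary_search (t lo hi : nat) : query_alg X T :=
  if t is t'.+1 then
    let mid := ((lo + hi)./2)%N in
    Query (Q mid) (fun a => if a == b then binary_search t' lo mid
                            else binary_search t' mid.+1 hi)
  else next hi.

(** Invariant: the answer is [b] at [hi] and differs from [b] just before [lo], a vacuous demand at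
    [lo = 0]. Each query halves the range, and at [lo = hi] the two facts meet. *)
Lemma binary_searchP (R : realType) (f : X -> bool) (t lo hi : nat) :
    (lo <= hi)%N -> (hi < lo + 2 ^ t)%N -> f (Q hi) = b ->
    (forall j, lo = j.+1 -> f (Q j) != b) ->
  exists q, [/\ (q <= hi)%N, f (Q q) = b, forall j, q = j.+1 -> f (Q j) != b,
    queries f (binary_search t lo hi) = (t + queries f (next q))%N &
    output_prob R f (binary_search t lo hi) =1 output_prob R f (next q)].
Proof.
elim: t lo hi => [|t IHt] lo hi lo_hi hi_lt f_hi f_lo /=.
  have hi_lo : hi = lo by lia.
  by exists hi; split=> // j; rewrite hi_lo => /f_lo.
rewrite expnS in hi_lt.
set mid := ((lo + hi)./2)%N.
have ? : (lo <= mid)%N by lia.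
have ? : (mid <= hi)%N by lia.
case: eqP => [f_mid|/eqP f_mid].
  have [//||//|//|q [? f_q f_q1 Dq Dp]] := IHt lo mid; first by lia.
  by exists q; split=> //; [lia | rewrite Dq addSn].
have mid_hi : (mid < hi)%N.
  have : mid != hi by apply: contraNneq f_mid => ->; exact/eqP.
  lia.
have [//||//||q [? f_q f_q1 Dq Dp]] := IHt mid.+1 hi; first by lia.
  by move=> j [<-].
by exists q; split=> //; rewrite Dq addSn.
Qed.

End BinarySearch.

Section Certify.
Context {n : nat} (x : cube n) (b : bool).

Definition restrict (S : {set 'I_n}) : cube n :=
  [ffun i => if i \in S then x i else ~~ b].

Definition add_prefix (S : {set 'I_n}) (q : nat) : {set 'I_n} :=
  S :|: [set i : 'I_n | (i < q)%N].

Lemma add_prefix0 S : add_prefix S 0 = S.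
Proof. by apply/setP=> i; rewrite !inE orbF. Qed.

(** This makes the union at which one search ends the very union from which the next one starts. *)
Lemma add_prefixS S (j : 'I_n) : add_prefix (j |: S) j = add_prefix S j.+1.
Proof.
apply/setP=> i; rewrite !inE ltnS [(i <= j)%N]leq_eqVlt.
by rewrite -val_eqE orbCA orbA.
Qed.

(** Such a [y] lies above [restrict S] if [b] is true and below it if [b] is false. *)
Lemma monotone_restrict {f : cube n -> bool} {S : {set 'I_n}} {y : cube n} :
    monotone f -> {in S, forall i, x i = b -> y i = b} ->
  f (restrict S) = b -> f y = b.
Proof.
move=> f_mono yS f_S.
have S_y i : restrict S i = b -> y i = b.
  by rewrite ffunE; case: ifP => [/yS //|_]; case: b.
case: b (restrict S) f_S S_y => p f_p p_y.
  have p_le i : (p i <= y i)%N by move: (p_y i); case: (p i) => // ->.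
  by have := f_mono _ _ p_le; rewrite f_p; case: (f y).
have p_ge i : (y i <= p i)%N by move: (p_y i); case: (p i); case: (y i) => // ->.
by have := f_mono _ _ p_ge; rewrite f_p; case: (f y).
Qed.

Lemma restrict_subset {f : cube n -> bool} {S W : {set 'I_n}} :
  monotone f -> S \subset W -> f (restrict S) = b -> f (restrict W) = b.
Proof.
move=> f_mono sSW; apply: monotone_restrict => // i iS xi.
by rewrite ffunE (subsetP sSW).
Qed.

(** Take a small certificate [C] at [restrict W], not at [x]. Then [W :&: C] still forces the value
    [b], so it contains each essential [i]. If [#|S| = k], the inclusion of [S] in [W :&: C] is an
    equality. *)
Lemma card_essential {f : cube n -> bool} {k : nat} {S W : {set 'I_n}} :
    monotone f -> (certificate_complexity f <= k)%N -> S \subset W ->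
    f (restrict W) = b -> {in S, forall i, f (restrict (W :\ i)) != b} ->
  (#|S| <= k)%N /\ (#|S| = k -> f (restrict S) = b).
Proof.
move=> f_mono fk sSW f_W essS.
have [C /certificateP cC Ck] := certificate_complexityP (restrict W) fk.
have f_WC : f (restrict (W :&: C)) = b.
  by rewrite -[RHS]f_W; apply: cC => i iC; rewrite !ffunE inE iC andbT.
have sSWC : S \subset W :&: C.
  apply/subsetP=> i iS; apply: contraT => i_notin.
  have/eqP[] := essS i iS; apply: (restrict_subset _ _ f_WC) => //.
  apply/subsetP=> j jWC; rewrite !inE; apply/andP; split.
    by apply: contraNneq i_notin => <-.
  by move: jWC; rewrite inE => /andP[].
have WCk : (#|W :&: C| <= k)%N.
  by apply: leq_trans Ck; rewrite subset_leq_card // subsetIr.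
split=> [|Sk]; first by apply: leq_trans WCk; exact: subset_leq_card.
by suff -> : S = W :&: C by []; apply/eqP; rewrite eqEcard sSWC Sk.
Qed.

(** [r] is the number of rounds left. The answer [q = 0] means that [S] alone forces the value.
    [insub] turns [q'] into a coordinate; its [None] case is a default, avoided as long as
    [hi <= n]. *)
Fixpoint certify (t r : nat) (S : {set 'I_n}) (hi : nat) :
    query_alg (cube n) {set 'I_n} :=
  if r is r'.+1 then
    binary_search b (restrict \o add_prefix S)
      (fun q => if q is q'.+1 then
                  if insub q' is Some j then certify t r' (j |: S) q'
                  else Return _ S
                else Return _ S) t 0 hi
  else Return _ S.

(** Induction on [r], keeping all of [S] essential to the current union. At [r = 0] the size of [S]
    is [k], and the equality case of [card_essential] applies. *)
Lemma certifyP (R : realType) (f : cube n -> bool) (k t r : nat)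
    (S : {set 'I_n}) (hi : nat) :
    monotone f -> (certificate_complexity f <= k)%N -> (n < 2 ^ t)%N ->
    (#|S| + r = k)%N -> (hi <= n)%N ->
    f (restrict (add_prefix S hi)) = b ->
    {in S, forall i, f (restrict (add_prefix S hi :\ i)) != b} ->
  exists S' : {set 'I_n}, [/\ f (restrict S') = b, (#|S'| <= k)%N,
    (queries f (certify t r S hi) <= r * t)%N &
    forall P, output_prob R f (certify t r S hi) P = (P S')%:R].
Proof.
move=> f_mono fk n_lt; elim: r S hi => [|r IHr] S hi Srk hi_n f_hi essS.
  have [Sk f_S] := card_essential f_mono fk (subsetUl _ _) f_hi essS.
  by exists S; split=> //; apply: f_S; rewrite -Srk addn0.
rewrite [certify _ _ _ _]/=.
set next := (next in binary_search _ _ next).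
have [//||//|//|q [q_hi f_q f_q1 -> Dp]] :=
  @binary_searchP _ _ b (restrict \o add_prefix S) next R f t 0 hi.
  by rewrite add0n; exact: leq_ltn_trans n_lt.
case: q => [|q] in q_hi f_q f_q1 Dp *.
  exists S; split=> [||//|P]; last by rewrite Dp.
  - by rewrite -[S]add_prefix0.
  - by lia.
  - by rewrite /=; lia.
have q_n : (q < n)%N by exact: leq_trans hi_n.
pose j := Ordinal q_n; have {f_q1}/= f_q1 := f_q1 q erefl.
have Dnext : next q.+1 = certify t r (j |: S) q.
  by rewrite /next insubT.
(* Otherwise [j] would not change the union, and the value could not cross there. *)
have jS : j \notin S.
  apply: contra f_q1 => jS; rewrite -[q]/(nat_of_ord j).
  have -> : add_prefix S j = add_prefix S q.+1.
    by rewrite -(add_prefixS _ j) (setUidPr _) ?sub1set.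
  exact/eqP.
have [||||S' [f_S' S'k qS' pS']] := IHr (j |: S) q.
- by rewrite cardsU1 jS; lia.
- exact: ltnW.
- by rewrite (add_prefixS _ j).
(* The new [j] is essential because removing it leaves a subset of [add_prefix S q]. *)
- move=> i; rewrite !inE => /predU1P[->|iS].
    apply: contra f_q1 => /eqP f_j; apply/eqP/(restrict_subset _ _ f_j) => //.
    by apply/subsetP=> l; rewrite !inE; case: (l == j).
  (* Old elements stay essential because the union only shrinks, as [q < hi]. *)
  rewrite (add_prefixS _ j); apply: contra (essS i iS) => /eqP f_i.
  apply/eqP/(restrict_subset _ _ f_i) => //; apply/setSD/setUS.
  by apply/subsetP=> l; rewrite !inE => /leq_trans; exact.
exists S'; split=> [//|//||P]; last by rewrite Dp Dnext pS'.
by rewrite -[X in queries f X]/(next q.+1) Dnext mulSn leq_add2l.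
Qed.

End Certify.

Theorem theorem1 (R : realType) (c : nat) :
  exists (B : R)
    (A : forall n k : nat, cube n -> query_alg (cube n) {set 'I_n}),
  forall (n k : nat) (f : cube n -> bool) (x : cube n),
    monotone f -> (certificate_complexity f <= k)%N ->
    (queries f (A n k x))%:R <= B * k%:R ^+ 8 * ln n%:R /\
    1 - (n%:R ^+ c)^-1 <=
      output_prob R f (A n k x)
        [pred S : {set 'I_n} | certificate f x S && (#|S| <= k)%N].
Proof.
(* With [L = trunc_log 2 n] the cost is at most [1 + k * (L + 1) <= 3 * k * L] for [k, L >= 1], and
   [L <= ln n / ln 2]. For [n <= 1] or [k = 0] the bound is 0 (with [ln 0 = 0]), so nothing may be
   queried. *)
exists (3 / ln 2), (fun n k x => if (n <= 1)%N || (k == 0%N) then Return _ set0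
  else Query x (fun b => certify x b (trunc_log 2 n).+1 k set0 n)).
move=> n k f x f_mono fk.
have ln2 : 0 < ln 2 :> R by rewrite ln_gt0 // ltr1n.
have bound_le1 : 1 - (n%:R ^+ c)^-1 <= 1 :> R.
  by rewrite lerBlDr lerDl invr_ge0 exprn_ge0.
case: ifP => [small|/negbT]; last first.
  rewrite negb_or -ltnNge -lt0n => /andP[n_gt1 k_gt0] /=.
  have [|||||S [f_S Sk qS ->]] := @certifyP n x (f x) R f k
    (trunc_log 2 n).+1 k set0 n f_mono fk.
  - exact: trunc_log_ltn.
  - by rewrite cards0.
  - by [].
  - by congr f; apply/ffunP=> i; rewrite ffunE !inE ltn_ord.
  - by move=> i; rewrite inE.
  split; last first.
    rewrite /= Sk andbT; suff -> : certificate f x S by [].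
    apply/certificateP=> y yS; apply: (monotone_restrict _ _ f_mono _ f_S) => i iS.
    by rewrite yS.
  set L := trunc_log 2 n in qS *.
  have L_gt0 : (0 < L)%N by rewrite trunc_log_gt0.
  have k_le : (k <= k ^ 8)%N by rewrite -[leqLHS]expn1 leq_pexp2l.
  have q_le : ((queries f (certify x (f x) L.+1 k set0 n)).+1 <= 3 * k ^ 8 * L)%N.
    by nia.
  have L_ln : L%:R <= ln n%:R / ln 2 :> R.
    rewrite ler_pdivlMr // mulr_natl -lnXn // -natrX ler_ln ?posrE ?ltr0n ?expn_gt0 //.
      by rewrite ler_nat trunc_logP // ltnW.
    exact: ltnW.
  have -> : 3 / ln 2 * k%:R ^+ 8 * ln n%:R = 3 * k%:R ^+ 8 * (ln n%:R / ln 2) :> R.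
    by field; rewrite gt_eqF.
  apply: (@le_trans _ _ (3 * k ^ 8 * L)%:R); first by rewrite ler_nat.
  by rewrite 2!natrM natrX ler_wpM2l // mulr_ge0 ?exprn_ge0.
split=> /=.
  rewrite !mulr_ge0 ?exprn_ge0 ?invr_ge0 //.
    exact: ltW.
  case: n {f x f_mono fk bound_le1 small} => [|n]; first by rewrite ln0.
  by rewrite ln_ge0 // ler1n.
rewrite cards0 andbT.
(* At [n = 1] the empty set may fail to certify, but the required probability is 0. *)
case: (n =P 1%N) => [n1|n_neq1].
  by rewrite [in n%:R]n1 expr1n invr1 subrr.
suff -> : certificate f x set0 by [].
case/orP: small => [n_le1|/eqP k0].
  apply/certificateP=> y _; congr f; apply/ffunP=> i.
  by have := ltn_ord i; lia.
have [S cS] := certificate_complexityP x fk.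
by rewrite k0 leqn0 cards_eq0 => /eqP<-.
Qed.
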